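(* Let $\Pi$ be a finite projective plane of order $n$ and $\Gamma_{\Pi}$ its Levi graph. If $k$ is an integer with $n \geq k \geq 4$, then $$c_{2k}(\Gamma_{\Pi}) \leq \frac{1}{2k}N_{(k)} - (n-k+2)(k-1)\,c_{2k-2}(\Gamma_{\Pi}).$$
   Context: $N = n^2+n+1$; for a positive integer $x$, $x_{(m)} = x(x-1)\cdots(x-m+1)$. The Levi graph $\Gamma_{\Pi}$ is the bipartite graph whose vertex classes are the points and the lines of $\Pi$, a point adjacent to a line iff it lies on it. $c_{m}(\Gamma_{\Pi})$ is the number of cycles of length $m$ in $\Gamma_{\Pi}$. *)

(* Defs.v *)
From mathcomp Require Import all_boot all_order all_algebra.

Set Implicit Arguments.
Unset Strict Implicit.
Unset Printing Implicit Defensive.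

Record projPlane := ProjPlane {
  point : finType;
  line : finType;
  incident : point -> line -> bool;
  join_axiom : forall p q : point, p != q ->
    exists! l : line, incident p l /\ incident q l;
  meet_axiom : forall l m : line, l != m ->
    exists! p : point, incident p l /\ incident p m;
  quadrangle_axiom : exists Q : {set point},
    #|Q| = 4 /\ forall l : line, #|[set p in Q | incident p l]| <= 2
}.

Definition has_order (Pi : projPlane) (n : nat) : Prop :=
  forall l : line Pi, #|[set p : point Pi | incident p l]| = n.+1.

Definition levi (Pi : projPlane) : rel (point Pi + line Pi) :=
  fun u v => match u, v with
  | inl p, inr l => incident p l
  | inr l, inl p => incident p l
  | _, _ => false
  end.

Definition cycle_edges (T : finType) (s : seq T) : {set {set T}} :=
  [set [set x; next s x] | x in s].

(* A cycle is a subgraph, not a vertex sequence: it is represented by its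
   edge set, so that the 2m sequences obtained from one another by rotation
   and reversal are counted once. *)
Definition cycles (T : finType) (e : rel T) (m : nat) : {set {set {set T}}} :=
  [set cycle_edges s | s : m.-tuple T & (2 < m) && ucycleb e s].

Definition num_cycles (T : finType) (e : rel T) (m : nat) : nat :=
  #|cycles e m|.

(* Main.v *)
Require Import Defs.
From mathcomp Require Import all_boot all_order all_algebra.
From mathcomp Require Import zify ring.

(* A 2k-cycle of the Levi graph is, up to the 2k rotations and reflections, a
   cyclic sequence of k distinct points whose k consecutive joins are distinct.
   So 2k c_{2k} counts the k-tuples of distinct points that are such "polygons".
   Inserting into a (k-1)-gon a new point q of the line joining its last and
   first points, and rotating the result, gives k-tuples of distinct points that
   are not polygons.  The inserted point is recovered as the unique point whose
   two adjacent joins coincide, so the insertions are all different; there are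
   at least k (n - k + 2) of them for each (k-1)-gon. *)

Set Implicit Arguments.
Unset Strict Implicit.
Unset Printing Implicit Defensive.

(** * Successors in duplicate-free cyclic sequences *)

Section CyclicSequences.

Variable T : eqType.
Implicit Types (s : seq T) (x : T).

Lemma nth_rot0 x0 s i : i < size s -> nth x0 (rot i s) 0 = nth x0 s i.
Proof. by move=> lt_i; rewrite nth_cat size_drop subn_gt0 lt_i nth_drop addn0. Qed.

Lemma rot_uniq_inj s i j : uniq s -> i < size s -> j < size s ->
  rot i s = rot j s -> i = j.
Proof.
case: s => [//|x0 s] us lti ltj eq_rot; apply/eqP.
by rewrite -(nth_uniq x0 lti ltj us) -nth_rot0 // eq_rot nth_rot0.
Qed.

Lemma next_nthS x0 s i : uniq s -> i.+1 < size s ->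
  next s (nth x0 s i) = nth x0 s i.+1.
Proof.
move=> us lti; rewrite next_nth mem_nth 1?ltnW // index_uniq 1?ltnW //.
by case: s us lti => //= y s _ lti; apply: set_nth_default.
Qed.

(** The sequences are rebuilt from their head, one successor at a time; each entry reached is
    already known to be common to both. *)
Lemma eq_from_next x0 s1 s2 : uniq s1 -> uniq s2 -> size s1 = size s2 ->
  nth x0 s1 0 = nth x0 s2 0 ->
  (forall x, x \in s1 -> x \in s2 -> next s1 x = next s2 x) -> s1 = s2.
Proof.
move=> us1 us2 sz12 hd12 nx12; apply: (@eq_from_nth _ x0) => // i.
elim: i => [//|i IHi] lti; have lti' := ltnW lti.
by rewrite -!next_nthS -?sz12 // -IHi // nx12 ?mem_nth // IHi ?mem_nth -?sz12.
Qed.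

Lemma next_neq s x : uniq s -> 1 < size s -> x \in s -> next s x != x.
Proof.
move=> us sz xs; case: (rot_to xs) => i s' rs.
rewrite -(next_rot i us); move: us sz; rewrite -(rot_uniq i) -(size_rot i) rs.
case: s' {rs} => [|y s'] //=; rewrite eqxx inE negb_or.
by case/andP=> /andP[xy _] _ _; rewrite eq_sym.
Qed.

Lemma next_next_neq s x : uniq s -> 2 < size s -> x \in s ->
  next s (next s x) != x.
Proof.
move=> us sz xs; case: (rot_to xs) => i s' rs.
rewrite -!(next_rot i us); move: us sz; rewrite -(rot_uniq i) -(size_rot i) rs.
case: s' {rs} => [|y [|z s']] //=; rewrite eqxx !inE !negb_or.
case/andP=> /and3P[/negPf xy xz _] _ _.
by rewrite (eq_sym y) xy eqxx eq_sym.
Qed.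

Lemma last_neq_head x s : uniq (x :: s) -> 1 < size (x :: s) -> last x s != x.
Proof.
case: s => [|y s] //= /andP[xs _] _.
by apply: contraNneq xs => {1}<-; apply: mem_last.
Qed.

Lemma next_last x s : uniq (x :: s) -> next (x :: s) (last x s) = x.
Proof.
by move=> us; rewrite next_nth mem_last index_last // nth_default.
Qed.

Lemma map_next_perm s : uniq s -> perm_eq (map (next s) s) s.
Proof.
move=> us; have umap : uniq (map (next s) s).
  by rewrite map_inj_uniq //; apply: can_inj (prev_next us).
have sub : {subset map (next s) s <= s}.
  by move=> _ /mapP[x xs ->]; rewrite mem_next.
have [_ eq_mem] := uniq_min_size umap sub (eq_leq (esym (size_map _ _))).
exact: uniq_perm.
Qed.

End CyclicSequences.

(** * Cycles as edge sets against cyclic vertex sequences *)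

Section CountingCycles.

Variables (T : finType) (e : rel T).
Hypothesis e_sym : symmetric e.

Lemma cycle_edges_rot (s : seq T) i : uniq s ->
  cycle_edges (rot i s) = cycle_edges s.
Proof.
move=> us; apply/setP=> E; apply/imsetP/imsetP=> -[x xs ->];
  by exists x; rewrite ?next_rot // mem_rot in xs *.
Qed.

Lemma cycle_edges_rev (s : seq T) : uniq s ->
  cycle_edges (rev s) = cycle_edges s.
Proof.
move=> us; apply/setP=> E; apply/imsetP/imsetP=> -[x xs ->].
  exists (prev s x); first by rewrite mem_prev -mem_rev.
  by rewrite next_rev // next_prev // setUC.
exists (next s x); first by rewrite mem_rev mem_next.
by rewrite next_rev // prev_next // setUC.
Qed.

Definition ucycles (m : nat) : {set m.-tuple T} :=
  [set s : m.-tuple T | ucycleb e s].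

(** The pair lists the 2m symmetries of an m-gon: a rotation index, and whether a reversal
    follows. *)
Definition dihedral m (s : m.-tuple T) (a : 'I_m * bool) : m.-tuple T :=
  if a.2 then [tuple of rev (rot a.1 s)] else [tuple of rot a.1 s].

Lemma dihedral_ucycle m (s : m.-tuple T) a :
  ucycleb e s -> ucycleb e (dihedral s a).
Proof.
case/andP=> cs us; apply/andP; case: a => i [] /=.
  by rewrite rev_cycle (eq_cycle (e' := e)) ?rot_cycle ?rev_uniq ?rot_uniq.
by rewrite rot_cycle rot_uniq.
Qed.

Lemma dihedral_edges m (s : m.-tuple T) a : uniq s ->
  cycle_edges (dihedral s a) = cycle_edges s.
Proof.
move=> us; case: a => i [];
  by rewrite /= ?cycle_edges_rev ?cycle_edges_rot ?rot_uniq.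
Qed.

(** If a rotation equalled a reversed rotation, [next] and [prev] would agree on [s], so two steps
    forward would return to the start; this is impossible with more than two entries. *)
Lemma dihedral_inj m (s : m.-tuple T) : 2 < m -> uniq s ->
  injective (dihedral s).
Proof.
move=> m_gt2 us; have sz := size_tuple s.
have rot_neq_rev (i j : 'I_m) : rot i s <> rev (rot j s).
  move=> eq_ij; have [x xs] : exists x, x \in (s : seq T).
    by exists (tnth s (Ordinal (ltnW (ltnW m_gt2)))); apply: mem_tnth.
  suff: next s (next s x) != x by rewrite -(next_rot i us (next s x)) eq_ij
    next_rev ?rot_uniq // prev_rot // prev_next // eqxx.
  by apply: next_next_neq; rewrite ?sz.
case=> i b [j c] /(congr1 val) /=.
have eq_rot: rot i s = rot j s -> i = j.
  by move/(rot_uniq_inj us) => eq_ij; apply/val_inj/eq_ij; rewrite sz.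
case: b c => [] [] /=; last by move/eq_rot ->.
- by move/(can_inj revK)/eq_rot ->.
- by move/esym/rot_neq_rev.
- by move/rot_neq_rev.
Qed.

(** The fibre of [cycle_edges] over a cycle contains the whole dihedral orbit of any sequence
    tracing it, that is 2m sequences. *)
Lemma num_cycles_le_ucycles m :
  (2 * m) * num_cycles e m <= #|ucycles m|.
Proof.
rewrite mulnC /num_cycles -sum_nat_const -sum1_card.
rewrite (partition_big (@cycle_edges T \o @tval m T) (fun _ => true)) //=.
(* Keep only the fibres over edge sets of cycles; the others can only enlarge the right-hand
   side. *)
rewrite [leqRHS](bigID (fun E => E \in cycles e m)) /=.
apply: leq_trans (leq_addr _ _); apply: leq_sum => E.
case/imsetP=> s; rewrite inE => /andP[m_gt2 cs] ->.
have us : uniq s by case/andP: cs.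
rewrite sum1dep_card.
have -> : 2 * m = #|[set: 'I_m * bool]|.
  by rewrite cardsT card_prod card_ord card_bool mulnC.
rewrite -(card_imset _ (dihedral_inj m_gt2 us)); apply: subset_leq_card.
apply/subsetP=> _ /imsetP[a _ ->]; rewrite !inE dihedral_ucycle //=.
by rewrite dihedral_edges.
Qed.

End CountingCycles.

(** * From cycles of the Levi graph to polygons of points *)

Section Polygons.

Variable Pi : projPlane.
Implicit Types (p q : point Pi) (l : line Pi).

(** Being a set, the join is defined for every pair of points; for distinct points it is a
    singleton. *)
Definition joins p q : {set line Pi} := [set l | incident p l & incident q l].

Lemma joins1 p q l : p != q -> incident p l -> incident q l ->
  joins p q = [set l].
Proof.
move=> /join_axiom[l0 [_ l0_uniq]] pl ql; have l0l := l0_uniq _ (conj pl ql).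
apply/setP=> m; rewrite !inE; apply/andP/eqP => [[pm qm]|-> //].
by rewrite -l0l (l0_uniq m).
Qed.

Definition polygon (s : seq (point Pi)) : bool :=
  uniq s && uniq [seq joins x (next s x) | x <- s].

Definition polygons m : {set m.-tuple (point Pi)} :=
  [set t : m.-tuple (point Pi) | polygon t].

Definition point_of (v : point Pi + line Pi) : option (point Pi) :=
  if v is inl p then Some p else None.

Definition corners (s : seq (point Pi + line Pi)) : seq (point Pi) :=
  pmap point_of s.

Lemma point_ofK : ocancel point_of inl.
Proof. by case. Qed.

Lemma mem_corners s p : (p \in corners s) = (inl p \in s).
Proof. exact: (can2_mem_pmap point_ofK). Qed.

Lemma corners_uniq s : uniq s -> uniq (corners s).
Proof. exact: (pmap_uniq point_ofK). Qed.

Lemma corners_rot i s : exists j, corners (rot i s) = rot j (corners s).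
Proof.
exists (size (corners (take i s))).
by rewrite -{3}(cat_take_drop i s) /corners !pmap_cat rot_size_cat.
Qed.

Lemma levi_sym : symmetric (@levi Pi).
Proof. by case=> [p|l] [q|m]. Qed.

Lemma corners_next_head p s : ucycleb (@levi Pi) (inl p :: s) ->
  2 < size (inl p :: s) ->
  exists2 l, next (inl p :: s) (inl p) = inr l
    & next (inl p :: s) (inr l) = inl (next (corners (inl p :: s)) p)
      /\ joins p (next (corners (inl p :: s)) p) = [set l].
Proof.
case: s => [|[r|l] [|[q|m] s]] //= /andP[] //=; last by case/andP.
case/and3P=> pl ql _; rewrite !inE !negb_or => /andP[/and3P[_ pq _] _] _.
exists l; first by rewrite eqxx.
by split; rewrite !eqxx //; apply: joins1.
Qed.

(** Rotating [p] to the front reduces this to the previous lemma, since [next] is invariant under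
    rotation and [corners] turns rotations into rotations. *)
Lemma corners_next s p : ucycleb (@levi Pi) s -> 2 < size s -> inl p \in s ->
  exists2 l, next s (inl p) = inr l
    & next s (inr l) = inl (next (corners s) p)
      /\ joins p (next (corners s) p) = [set l].
Proof.
move=> cs sz ps; have us : uniq s by case/andP: cs.
have [i s' rs] := rot_to ps; have [j cj] := corners_rot i s.
rewrite -(next_rot j (corners_uniq us)) -cj -(next_rot i us).
have := @corners_next_head p s'; rewrite -rs size_rot.
have -> : ucycleb (@levi Pi) (rot i s) by rewrite /ucycleb rot_cycle rot_uniq.
by case=> // l nl [nnl jl]; exists l; rewrite // -(next_rot i us).
Qed.

(** The successor map permutes the entries and exchanges points with lines, so there are as many
    points as lines. *)
Lemma size_corners s : ucycleb (@levi Pi) s -> 2 * size (corners s) = size s.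
Proof.
case/andP=> cs us; rewrite size_pmap -(count_predC point_of s) mul2n -addnn.
congr (_ + _); rewrite -(permP (map_next_perm us)) count_map.
apply: eq_in_count => v vs /=; move: (next_cycle cs vs).
by case: v {vs} => [p|l]; case: (next s _).
Qed.

(** The join at a corner is the line that follows it on the cycle, and distinct corners have
    distinct successors. *)
Lemma corners_polygon s : ucycleb (@levi Pi) s -> 2 < size s ->
  polygon (corners s).
Proof.
move=> cs sz; have us : uniq s by case/andP: cs.
rewrite /polygon corners_uniq //= map_inj_in_uniq ?corners_uniq // => p q.
rewrite !mem_corners => ps qs.
have [l pl [_ ->]] := corners_next cs sz ps.
have [m qm [_ ->]] := corners_next cs sz qs.
move=> /set1_inj lm; have: next s (inl p) = next s (inl q) by rewrite pl qm lm.
by move/(can_inj (prev_next us)) => -[].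
Qed.

Definition starts_at_point (s : seq (point Pi + line Pi)) : bool :=
  if s is inl _ :: _ then true else false.

(** Each line of the cycle is recovered as the join of the corners around it; starting at a point
    fixes where the sequence begins. *)
Lemma corners_inj s1 s2 : ucycleb (@levi Pi) s1 -> ucycleb (@levi Pi) s2 ->
  2 < size s1 -> size s1 = size s2 ->
  starts_at_point s1 -> starts_at_point s2 ->
  corners s1 = corners s2 -> s1 = s2.
Proof.
move=> cs1 cs2 sz sz12 hd1 hd2 eqc.
have us1 : uniq s1 by case/andP: cs1.
have us2 : uniq s2 by case/andP: cs2.
have sz2 : 2 < size s2 by rewrite -sz12.
have nextP p : inl p \in s1 -> exists2 l, next s1 (inl p) = inr l /\
    next s2 (inl p) = inr l & next s1 (inr l) = next s2 (inr l).
  move=> ps1; have ps2 : inl p \in s2 by rewrite -mem_corners -eqc mem_corners.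
  have [l pl [pql j1]] := corners_next cs1 sz ps1.
  have [m pm [pqm]] := corners_next cs2 sz2 ps2.
  rewrite -eqc j1 => /set1_inj lm; rewrite -lm -eqc in pm pqm.
  by exists l; rewrite ?pql.
case: s1 hd1 cs1 sz sz12 eqc us1 nextP => [|[p1|l1] r1] // _.
case: s2 hd2 cs2 us2 {sz2} => [|[p2|l2] r2] // _.
move=> cs2 us2 cs1 _ sz12 eqc us1 nextP.
apply: (@eq_from_next _ (inl p1)) => //; first by case: eqc => ->.
case=> [p|l] s1v s2v; first by have [l [-> ->]] := nextP p s1v.
(* [nextP] starts from a point, so the line [l] is reached through its predecessor on the cycle,
   which is a point. *)
have := prev_cycle (proj1 (andP cs1)) s1v.
have: prev (inl p1 :: r1) (inr l) \in inl p1 :: r1 by rewrite mem_prev.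
case E: (prev _ _) => [p|//] ps1 _; have [m [pm _]] := nextP p ps1.
by rewrite -E next_prev // in pm; case: pm => <-.
Qed.

(** A cycle of length 2m is traced by at least 4m sequences; at least half of all such sequences
    start at a point, and these embed into the polygons through [corners]. *)
Lemma num_cycles_le_polygons m : 1 < m ->
  2 * m * num_cycles (@levi Pi) (2 * m) <= #|polygons m|.
Proof.
move=> m_gt1; have sz_gt2 : 2 < 2 * m by lia.
pose U := ucycles (@levi Pi) (2 * m).
have leU : #|U| <= 2 * #|[set s in U | starts_at_point s]|.
  have {1}-> : U = [set s in U | starts_at_point s]
                :|: [set s in U | ~~ starts_at_point s].
    by apply/setP=> s; rewrite !inE -andb_orr orbN andbT.
  apply: leq_trans (leq_card_setU _ _) _; rewrite [leqRHS]mul2n -addnn leq_add2l.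
  (* Rotating by one place sends the sequences that start at a line injectively to sequences that
     start at a point. *)
  pose rot1 (s : (2 * m).-tuple (point Pi + line Pi)) := [tuple of rot 1 s].
  have rot1_inj : injective rot1.
    by move=> s1 s2 /(congr1 val) /= /rot_inj /val_inj.
  rewrite -(card_imset _ rot1_inj); apply: subset_leq_card.
  apply/subsetP=> _ /imsetP[s + ->]; rewrite !inE => /andP[cs].
  have cs' : ucycleb (@levi Pi) (rot 1 s) by rewrite /ucycleb rot_cycle rot_uniq.
  rewrite cs' /starts_at_point /=; case/andP: cs => + _.
  move: (size_tuple s) sz_gt2.
  by case: (tval s) => [|[p|l] [|[q|l'] r]] //= <-.
have szc (s : (2 * m).-tuple (point Pi + line Pi)) :
    s \in U -> size (corners s) = m.
  by rewrite inE => /size_corners/eqP; rewrite size_tuple eqn_pmul2l // => /eqP.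
have le_pol : #|[set s in U | starts_at_point s]| <= #|polygons m|.
  have [/eqP ->|/set0Pn[s0]] := boolP ([set s in U | starts_at_point s] == set0).
    by rewrite cards0.
  rewrite inE => /andP[s0U _].
  (* The corners of [s0] serve only as the default of [insubd]; on [U] the length is m and the
     default never appears. *)
  pose f (s : (2 * m).-tuple (point Pi + line Pi)) : m.-tuple (point Pi) :=
    insubd (Tuple (introT eqP (szc s0 s0U))) (corners s).
  have fE s : s \in U -> f s = corners s :> seq _.
    by move=> sU; rewrite val_insubd szc ?eqxx.
  rewrite -(@card_in_imset _ _ f) => [|s1 s2].
    apply: subset_leq_card; apply/subsetP=> _ /imsetP[s + ->].
    rewrite !inE => /andP[cs _]; rewrite fE ?inE //.
    by apply: corners_polygon; rewrite ?size_tuple.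
  rewrite [_ \in [set _ in _ | _]]inE => /andP[s1U h1].
  rewrite [_ \in [set _ in _ | _]]inE => /andP[s2U h2].
  move/(congr1 val) => /=; rewrite !fE // => eqc; apply: val_inj => /=.
  by rewrite !inE in s1U s2U; apply: corners_inj; rewrite ?size_tuple.
have := num_cycles_le_ucycles levi_sym (2 * m); rewrite -/U; lia.
Qed.

End Polygons.

(** Turns the bound on the number of points into a bound on the number of tuples of distinct
    points. *)
Lemma leq_ffact a b m : a <= b -> a ^_ m <= b ^_ m.
Proof.
elim: m a b => [|m IHm] a b leab; first by rewrite !ffactn0.
by rewrite !ffactnS leq_mul ?IHm //; lia.
Qed.

Lemma leq_card_bigcup (I T : finType) (A : {set I}) (F : I -> {set T}) :
  #|\bigcup_(i in A) F i| <= \sum_(i in A) #|F i|.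
Proof.
elim/big_rec2: _ => [|i N B _ leB]; first by rewrite cards0.
by apply: leq_trans (leq_card_setU _ _) _; rewrite leq_add2l.
Qed.

(** * Inserting a point on a side of a polygon *)

Section Insertion.

Variable Pi : projPlane.
Implicit Types (p q x y : point Pi) (l : line Pi) (t : seq (point Pi)).

(** New points go on the closing side only; the other sides are reached by starting from a rotation
    of the polygon. *)
Definition insertable t : {set point Pi} :=
  if t is h :: t' then
    [set q | (q \notin t) && [exists l in joins (last h t') h, incident q l]]
  else set0.

Lemma polygon_step_inj t : polygon t ->
  {in t &, injective (fun x => joins x (next t x))}.
Proof.
case/andP=> ut uj x y xt yt /= eq_xy; apply/eqP.
have ltx := xt; have lty := yt; rewrite -!index_mem in ltx lty.
have := nth_uniq set0 _ _ uj; rewrite size_map => /(_ _ _ ltx lty).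
by rewrite !(nth_map x) // !nth_index // eq_xy eqxx => /esym/eqP/(index_inj _ xt) ->.
Qed.

Lemma insertable_line h t q : uniq (h :: t) -> 1 < size (h :: t) ->
  q \in insertable (h :: t) ->
  joins (last h t) q = joins (last h t) h /\ joins q h = joins (last h t) h.
Proof.
move=> ut sz; rewrite inE => /andP[qnt /existsP[l /andP[]]].
rewrite inE => /andP[ll hl] ql.
rewrite (joins1 (last_neq_head ut sz) ll hl).
split; apply: joins1 => //; apply: contraNneq qnt.
  by move=> <-; apply: mem_last.
by move=> ->; apply: mem_head.
Qed.

Lemma insertable_notin t q : q \in insertable t -> q \notin t.
Proof. by case: t => [|h t]; rewrite inE // => /andP[]. Qed.

(** Only the successor of the last entry changes, from the head to [q], and [q] lies on the same
    closing line. *)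
Lemma insertion_step t q x : uniq t -> 1 < size t -> q \in insertable t ->
  x \in t -> joins x (next (q :: t) x) = joins x (next t x).
Proof.
move=> ut sz qt xt; have uqt : uniq (q :: t) by rewrite /= insertable_notin.
case: t => // h t in ut sz qt xt uqt *.
have [jq _] := insertable_line ut sz qt.
have [->|xl] := eqVneq x (last h t).
  by rewrite (next_last ut) (next_last uqt : next _ (last h t) = q).
have lti : (index x (h :: t)).+1 < size (h :: t).
  have : index x (h :: t) < size (h :: t) by rewrite index_mem.
  rewrite leq_eqVlt => /predU1P[[ix]|//]; case/eqP: xl.
  by rewrite -[last h t]/(last x (h :: t)) -nth_last -[_.-1]/(size t) -ix nth_index.
have := next_nthS x ut lti; rewrite nth_index // => ->.
(* Putting [q] in front shifts every index of [h :: t] by one. *)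
have := @next_nthS _ x (q :: h :: t) (index x (h :: t)).+1 uqt lti.
by rewrite -[nth x (q :: _) _.+1]/(nth x (h :: t) _) nth_index // => ->.
Qed.

Lemma insertion_flat t q : uniq t -> 1 < size t -> q \in insertable t ->
  joins (prev (q :: t) q) q = joins q (next (q :: t) q).
Proof.
move=> ut sz qt; have uqt : uniq (q :: t) by rewrite /= insertable_notin.
case: t => // h t in ut sz qt uqt *; have [jq jh] := insertable_line ut sz qt.
have <- : last h t = prev (q :: h :: t) q.
  by have := prev_next uqt (last q (h :: t)); rewrite (next_last uqt).
by rewrite jq /= eqxx jh.
Qed.

(** Equal joins on both sides of an old vertex would make two sides of [t] coincide, because every
    side of [t] survives the insertion as a join. *)
Lemma insertion_flat_unique t q x : polygon t -> 1 < size t ->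
  q \in insertable t -> x \in q :: t ->
  joins (prev (q :: t) x) x = joins x (next (q :: t) x) -> x = q.
Proof.
move=> pt sz qt; have ut : uniq t by case/andP: pt.
have uqt : uniq (q :: t) by rewrite /= insertable_notin.
rewrite in_cons => /predU1P[// | xt]; rewrite insertion_step //.
set y := prev _ _; have nyx : next (q :: t) y = x by apply: next_prev.
have : y \in q :: t by rewrite mem_prev in_cons xt orbT.
rewrite in_cons => /predU1P[yq | yt]; last first.
  rewrite -[in LHS]nyx insertion_step // => /(polygon_step_inj pt yt xt) yx.
  suff: next (q :: t) y != y by rewrite nyx yx eqxx.
  by apply: (next_neq uqt (ltnW sz)); rewrite in_cons yt orbT.
(* If the predecessor is [q] itself, then [x] is the head and the side before it is the closing side
   of [t]. *)
case: t => // h t in pt sz qt ut uqt xt y nyx yq *.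
have xh : x = h by rewrite -nyx yq /= eqxx.
have [_ jh] := insertable_line ut sz qt.
have step : joins (last h t) (next (h :: t) (last h t)) = joins h (next (h :: t) h)
    -> last h t = h := polygon_step_inj pt (mem_last h t) (mem_head h t).
rewrite yq xh jh => eqj; case/eqP: (last_neq_head ut sz).
by apply: step; rewrite next_last.
Qed.

Lemma insertion_not_polygon t q i : uniq t -> 1 < size t -> q \in insertable t ->
  ~~ polygon (rot i (q :: t)).
Proof.
move=> ut sz qt; have uqt : uniq (q :: t) by rewrite /= insertable_notin.
have := insertion_flat ut sz qt; have := mem_head q t.
move: (q :: t) (ltnW sz : 1 < size (q :: t)) uqt => s szs us qs flat.
apply/negP=> /polygon_step_inj step_inj.
have /= := step_inj (prev s q) q; rewrite !mem_rot mem_prev !next_rot //.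
rewrite next_prev // flat => /(_ qs qs erefl) pq.
by have := next_neq us szs qs; rewrite -{1}pq next_prev // eqxx.
Qed.

(** Equal rotations share [next] and [prev], hence the flat point: [q1 = q2]. Unrolling from it
    gives [t1 = t2], and distinctness of the entries fixes the rotation index. *)
Lemma insertion_inj t1 t2 q1 q2 i1 i2 : polygon t1 -> polygon t2 ->
  1 < size t1 -> size t1 = size t2 ->
  q1 \in insertable t1 -> q2 \in insertable t2 ->
  i1 <= size t1 -> i2 <= size t2 ->
  rot i1 (q1 :: t1) = rot i2 (q2 :: t2) -> [/\ t1 = t2, q1 = q2 & i1 = i2].
Proof.
move=> pt1 pt2 sz sz12 qt1 qt2 lt1 lt2 eqr.
have ut1 : uniq t1 by case/andP: pt1.
have ut2 : uniq t2 by case/andP: pt2.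
have uqt1 : uniq (q1 :: t1) by rewrite /= insertable_notin.
have uqt2 : uniq (q2 :: t2) by rewrite /= insertable_notin.
have eqn : next (q1 :: t1) =1 next (q2 :: t2).
  by move=> x; rewrite -(next_rot i1 uqt1) eqr next_rot.
have eqp : prev (q1 :: t1) =1 prev (q2 :: t2).
  by move=> x; rewrite -(prev_rot i1 uqt1) eqr prev_rot.
have q12 : q1 = q2.
  apply: (insertion_flat_unique pt2 _ qt2); rewrite -?sz12 //.
    by rewrite -(mem_rot i2) -eqr mem_rot mem_head.
  by rewrite -eqn -eqp insertion_flat.
have eqt : q1 :: t1 = q2 :: t2.
  by apply: (@eq_from_next _ q1) => //; rewrite /= sz12.
case: (eqt) => _ t12; split=> //.
by rewrite -eqt in eqr; apply: (rot_uniq_inj uqt1 _ _ eqr); rewrite /= ltnS // t12.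
Qed.

Lemma insertable_card n t : has_order Pi n -> uniq t -> 1 < size t ->
  n.+1 - size t <= #|insertable t|.
Proof.
case: t => // h t hn ut sz.
have [l [[ll hl] _]] := join_axiom (last_neq_head ut sz).
have -> : insertable (h :: t) = [set q | incident q l] :\: [set x in h :: t].
  apply/setP=> q; rewrite !inE (joins1 (last_neq_head ut sz) ll hl).
  congr (_ && _); apply/existsP/idP => [[m]|ql].
    by rewrite inE => /andP[/eqP ->].
  by exists l; rewrite inE eqxx.
rewrite cardsD hn leq_sub2l //.
apply: leq_trans (subset_leq_card (subsetIr _ _)) _.
by rewrite cardsE card_size.
Qed.

(** Polygons and rotated insertions are disjoint families of tuples of distinct points; each polygon
    contributes m+1 rotations of at least n+1-m insertions. *)
Lemma polygons_insertion n m : has_order Pi n -> 1 < m ->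
  #|polygons Pi m.+1| + m.+1 * (n.+1 - m) * #|polygons Pi m| <=
    #|point Pi| ^_ m.+1.
Proof.
move=> hn m_gt1.
pose S := [set a : m.-tuple (point Pi) * (point Pi * 'I_m.+1) |
  (a.1 \in polygons Pi m) && (a.2.1 \in insertable a.1)].
pose F (a : m.-tuple (point Pi) * (point Pi * 'I_m.+1)) :=
  [tuple of rot a.2.2 (a.2.1 :: a.1)].
have SP a : a \in S -> [/\ polygon a.1, uniq a.1, 1 < size a.1
    & a.2.1 \in insertable a.1].
  by rewrite !inE size_tuple => /andP[/[dup] pt /andP[ut _] qt].
have cardS : m.+1 * (n.+1 - m) * #|polygons Pi m| <= #|S|.
  rewrite mulnC -sum_nat_const -sum1dep_card.
  rewrite -(pair_big_dep (fun u => u \in polygons Pi m)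
    (fun u b => b.1 \in insertable u) (fun _ _ => 1)) /=.
  apply: leq_sum => t; rewrite inE => /andP[ut _].
  rewrite (eq_bigl (fun b => b \in setX (insertable t) [set: 'I_m.+1])) => [|b].
    rewrite sum1_card cardsX cardsT card_ord mulnC leq_mul2r.
    by have := insertable_card hn ut; rewrite size_tuple => ->.
  by rewrite !inE andbT.
have F_inj : {in S &, injective F}.
  move=> [t1 [q1 i1]] [t2 [q2 i2]] /SP[/= p1 _ s1 h1] /SP[/= p2 _ s2 h2].
  move/(congr1 val) => /= /insertion_inj.
  rewrite !size_tuple in s1 *.
  case/(_ p1 p2 s1 erefl h1 h2 (ltn_ord i1) (ltn_ord i2)).
  by move=> /val_inj -> -> /val_inj ->.
have disj : [disjoint polygons Pi m.+1 & [set F a | a in S]].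
  rewrite disjoint_sym; apply/pred0P=> u /=; apply/negP=> /andP[].
  move=> /imsetP[a /SP[_ ua sa ha] ->]; rewrite inE; apply/negP.
  exact: insertion_not_polygon.
rewrite -card_uniq_tuples; apply: leq_trans (leq_add (leqnn _) cardS) _.
rewrite -(card_in_imset F_inj).
(* Disjointness is the equality case of the union bound, so the sum becomes the size of a union. *)
move: disj; rewrite -(leq_card_setU _ _).2 => /eqP <-.
apply: subset_leq_card; apply/subsetP=> u; rewrite !inE all_predT /=.
case/orP=> [/andP[] // | /imsetP[a /SP[_ ua sa ha] ->]].
by rewrite rot_uniq /= insertable_notin.
Qed.

(** The lines from a point [p] off [l] to the n+1 points of [l] cover the plane, each with n points
    besides [p]. *)
Lemma card_point_le n : has_order Pi n -> #|point Pi| <= n ^ 2 + n + 1.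
Proof.
move=> hn; have [Q [cardQ lineQ]] := quadrangle_axiom Pi.
have /card_gt1P[a [b [_ _ ab]]] : 1 < #|Q| by rewrite cardQ.
have [l _] := join_axiom ab.
(* At most two of the four points of the quadrangle lie on [l]. *)
have [p _ pnl] : exists2 p, p \in Q & ~~ incident p l.
  apply/exists_inP; apply: contraT; rewrite negb_exists_in => /forall_inP Ql.
  have : Q \subset [set p in Q | incident p l].
    by apply/subsetP=> p pQ; rewrite inE pQ; have := Ql p pQ; rewrite negbK.
  by move/subset_leq_card/leq_trans/(_ (lineQ l)); rewrite cardQ.
pose pencil r := [set q | [exists m in joins p r, incident q m]] :\ p.
have cover : [set: point Pi] \subset
    p |: \bigcup_(r in [set r | incident r l]) pencil r.
  apply/subsetP=> q _; rewrite in_setU1; have [//|qp /=] := eqVneq q p.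
  have [m [[qm pm] _]] := join_axiom qp.
  have ml : m != l by apply: contraNneq pnl => <-.
  have [r [[rm rl] _]] := meet_axiom ml.
  apply/bigcupP; exists r; first by rewrite inE.
  by rewrite !inE qp; apply/existsP; exists m; rewrite inE pm rm.
have card_pencil r : incident r l -> #|pencil r| = n.
  move=> rl; have pr : p != r by apply: contraNneq pnl => ->.
  have [m [[pm rm] _]] := join_axiom pr.
  suff -> : pencil r = [set q | incident q m] :\ p.
    by have := cardsD1 p [set q | incident q m]; rewrite hn inE pm => -[].
  apply/setP=> q; rewrite !inE (joins1 pr pm rm); congr (_ && _).
  apply/existsP/idP => [[m']|qm]; first by rewrite inE => /andP[/eqP ->].
  by exists m; rewrite inE eqxx.
rewrite -cardsT; apply: leq_trans (subset_leq_card cover) _.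
apply: leq_trans (leq_card_setU _ _) _; rewrite cards1 addnC leq_add2r.
apply: leq_trans (leq_card_bigcup _ _) _.
rewrite (eq_bigr (fun=> n)) => [|r]; last by rewrite inE => /card_pencil.
by rewrite sum_nat_const hn; lia.
Qed.

End Insertion.

(** * The inequality over the rationals *)

Import GRing.Theory Num.Theory.
Local Open Scope ring_scope.

Theorem theorem4 (Pi : projPlane) (n k : nat)
    (hn : has_order Pi n) (hk4 : (4 <= k)%N) (hkn : (k <= n)%N) :
  ((num_cycles (@levi Pi) (2 * k))%:R : rat)
    <= (2 * k)%:R^-1 * ((n ^ 2 + n + 1) ^_ k)%:R
       - (n%:R - k%:R + 2) * (k%:R - 1)
         * (num_cycles (@levi Pi) (2 * k - 2))%:R.
Proof.
case: k => [//|m] in hk4 hkn *.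
have m_gt1 : (1 < m)%N by lia.
have cycSm := num_cycles_le_polygons Pi (ltnW m_gt1 : (1 < m.+1)%N).
have cycm := num_cycles_le_polygons Pi m_gt1.
have := leq_trans (polygons_insertion hn m_gt1) (leq_ffact m.+1 (card_point_le hn)).
have -> : (2 * m.+1 - 2 = 2 * m)%N by lia.
move: (num_cycles _ (2 * m.+1)) (num_cycles _ (2 * m)) cycSm cycm.
move=> c c' cycSm cycm ins.
(* With k = m+1, this is the claim multiplied by 2k; the factor m comes from the 2m polygons that
   each shorter cycle contributes. *)
have key : ((c + (n.+1 - m) * m * c') * (2 * m.+1) <=
    (n ^ 2 + n + 1) ^_ m.+1)%N.
  apply: leq_trans ins.
  apply: leq_trans (leq_add cycSm (leq_mul (leqnn (m.+1 * (n.+1 - m))) cycm)).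
  by rewrite leq_eqVlt; apply/orP; left; apply/eqP; ring.
(* The truncated subtraction is exact here because m < n. *)
have -> : n%:R - m.+1%:R + 2 = (n.+1 - m)%:R :> rat.
  by rewrite natrB; [rewrite -!natr1; ring | lia].
have -> : m.+1%:R - 1 = m%:R :> rat by rewrite -natr1 addrK.
by rewrite lerBrDr [leRHS]mulrC ler_pdivlMr ?ltr0n // -!natrM -natrD -natrM ler_nat.
Qed.
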